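(* Let $X$ be a Banach space. There exist sequences $\{a_i\}_{i\ge2}$ and $\{b_i\}_{i\ge2}$ of real numbers such that, for any positive integer $p$, any function $u\in C^{p+1}([0,T],X)$ and a partition $0=t_0<t_1<\dots<t_N=T$, $t_n=nk$, of $[0,T]$, we have $$u'(t_n)=\frac{u(t_{n+1})-u(t_n)}{k}-\sum_{i=2}^{p}a_ik^{i-1}D_-^{\tau(i)}(D_+D_-)^{\mu(i)}u(t_n)+O(k^p)$$ and $$u'(t_{n+1})=\frac{u(t_{n+1})-u(t_n)}{k}+\sum_{i=2}^{p}b_ik^{i-1}D_-^{\tau(i)}(D_+D_-)^{\mu(i)}u(t_{n+1})+O(k^p),$$ for $\mu(p)+\tau(p)\le n\le N-\mu(p)$ (and such that all nodes appearing in the respective formula belong to $\{t_0,\dots,t_N\}$), where $\mu(i)$ and $\tau(i)$ are, respectively, the quotient and the remainder of the Euclidean division of the integer $i$ by $2$, that is $i=2\mu(i)+\tau(i)$, $\tau(i)\in\{0,1\}$. The error constants for these two finite difference approximations are $a_{p+1}$ and $b_{p+1}$, respectively, and we have the relations $a_2=b_2$ and $a_i=-b_i$ for $i=3,4,\dots$. The first coefficients are $$a_2=\tfrac12,\quad a_3=\tfrac1{3!},\quad a_4=\tfrac2{4!},\quad a_5=-\tfrac4{5!},\quad a_6=-\tfrac{12}{6!},\quad a_7=\tfrac{36}{7!},\quad a_8=\tfrac{144}{8!},\quad a_9=-\tfrac{576}{9!},\quad a_{10}=-\tfrac{2880}{10!},\quad a_{11}=\tfrac{14400}{11!}.$$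
   Context: $k>0$ is the spacing and $t_n=nk$. $D_+v(t_n)=\frac{v(t_{n+1})-v(t_n)}{k}$, $D_-v(t_n)=\frac{v(t_n)-v(t_{n-1})}{k}$; powers and composites are defined recursively (power $0$ is the identity). The constants implied in $O(k^p)$ (as $k\to0$) may depend on $u$ and $p$ but not on $k$ or $n$. The error constant of an approximation formula for $u'(s)$ with remainder (exact value minus approximation) $O(k^p)$ is the number $C$, considered up to sign, such that the remainder equals $\pm Ck^pu^{(p+1)}(s)+o(k^p)$ as $k\to0$, uniformly in $n$, with a fixed sign; here $s=t_n$ for the first formula and $s=t_{n+1}$ for the second. *)

(* Defs.v *)
(* MathComp-Analysis. *)
From HB Require Import structures.
From mathcomp Require Import all_boot all_order all_algebra.
From mathcomp Require Import all_classical all_reals all_analysis.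

Set Implicit Arguments.
Unset Strict Implicit.
Unset Printing Implicit Defensive.

Import Order.TTheory GRing.Theory Num.Theory.
Import numFieldNormedType.Exports.

Local Open Scope classical_set_scope.
Local Open Scope ring_scope.

Section Derivatives.
Context {R : realType} {X : normedModType R}.
Implicit Types (A : set R) (f : R -> X).

(* The increment h is restricted to x + h \in A, so that derivatives are
   one-sided at the endpoints of an interval and values of f outside A are
   irrelevant. *)
Definition diff_quot_within A f (x : R) : set_system X :=
  (fun h => h^-1 *: (f (x + h) - f x)) @ within [set h | A (x + h)] 0^'.

Definition derivable_within A f (x : R) : Prop := cvg (diff_quot_within A f x).

Definition derive_within A f (x : R) : X := lim (diff_quot_within A f x).

Definition derive_within_n A (j : nat) f : R -> X := iter j (derive_within A) f.

Definition class_C (m : nat) A f : Prop :=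
  (forall j x, (j < m)%N -> A x -> derivable_within A (derive_within_n A j f) x)
  /\ {within A, continuous (derive_within_n A m f)}.

End Derivatives.

Definition mu (i : nat) : nat := (i %/ 2)%N.
Definition tau (i : nat) : nat := (i %% 2)%N.

Section FiniteDifferences.
Context {R : realType} {X : normedModType R}.
Implicit Types (k : R) (v u : R -> X) (a b : nat -> R) (p n N : nat).

Definition node k n : R := n%:R * k.

(* At a node, t_n + k = t_(n+1) and t_n - k = t_(n-1). *)
Definition Dplus k v : R -> X := fun t => k^-1 *: (v (t + k) - v t).
Definition Dminus k v : R -> X := fun t => k^-1 *: (v t - v (t - k)).

(* D_-^tau(i) (D_+ D_-)^mu(i) v *)
Definition Dcomp k (i : nat) v : R -> X :=
  iter (tau i) (Dminus k) (iter (mu i) (Dplus k \o Dminus k) v).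

Definition formula1 a p k u n : X :=
  k^-1 *: (u (node k n.+1) - u (node k n))
  - \sum_(2 <= i < p.+1) (a i * k ^+ i.-1) *: Dcomp k i u (node k n).

Definition formula2 b p k u n : X :=
  k^-1 *: (u (node k n.+1) - u (node k n))
  + \sum_(2 <= i < p.+1) (b i * k ^+ i.-1) *: Dcomp k i u (node k n.+1).

End FiniteDifferences.

(* mu(p) + tau(p) <= n <= N - mu(p), and all nodes occurring in the formula are
   among t_0, ..., t_N.  Since Dcomp k i v t_m involves exactly the nodes
   t_(m - mu i - tau i), ..., t_(m + mu i), the nodes of formula1 have indices
   at most max(n + 1, n + mu p) and those of formula2 at most n + 1 + mu p; the
   lower bound on n takes care of the smallest index in both cases. *)
Definition admissible1 (p N n : nat) : bool :=
  [&& mu p + tau p <= n, n + mu p <= N & n.+1 <= N]%N.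
Definition admissible2 (p N n : nat) : bool :=
  [&& mu p + tau p <= n, n + mu p <= N & n.+1 + mu p <= N]%N.

Section Remainders.
Context {R : realType} {X : normedModType R}.
(* [formula k u n] is an approximation of u'(t_(pt n)), to be used for the
   indices n such that [adm N n]. *)
Variables (formula : R -> (R -> X) -> nat -> X) (adm : nat -> nat -> bool).
Variables (pt : nat -> nat) (p : nat).

Definition remainder (T k : R) (u : R -> X) (n : nat) : X :=
  derive_within `[0, T] u (node k (pt n)) - formula k u n.

(* The remainder is O(k^p), with a constant independent of k and n. *)
Definition approx_order : Prop :=
  forall (T : R) (u : R -> X), 0 < T -> class_C p.+1 `[0, T] u ->
  exists M : R, forall (k : R) (N n : nat),
    0 < k -> node k N = T -> adm N n ->
    `|remainder T k u n| <= M * k ^+ p.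

(* The remainder is +- C k^p u^(p+1) + o(k^p), uniformly in n; the sign depends
   on the formula only. *)
Definition error_constant (C : R) : Prop :=
  exists s : bool, forall (T : R) (u : R -> X),
  0 < T -> class_C p.+1 `[0, T] u ->
  forall e : R, 0 < e -> exists2 d : R, 0 < d &
  forall (k : R) (N n : nat),
    0 < k < d -> node k N = T -> adm N n ->
    `|remainder T k u n
      - ((-1) ^+ s * C * k ^+ p)
          *: derive_within_n `[0, T] p.+1 u (node k (pt n))| <= e * k ^+ p.

End Remainders.

(* Main.v *)
(** The Gauss polynomials N_i(x) = binomial(x + mu i, i) satisfy
    D_+D_- N_(i+2) = N_i (for k = 1), hence are dual at 0 to the operators
    D_-^tau(i) (D_+D_-)^mu(i).  Testing on the N_i, every polynomial f of degree
    at most p satisfies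
      f(e+1) - f(e) - f'(0) = sum_(2 <= i <= p) c_i (D_-^tau(i) (D_+D_-)^mu(i) f)(0)
    with c_i = N_i(e+1) - N_i(e) - N_i'(0), and for f = x^(p+1)/(p+1)! the two
    sides differ by c_(p+1).  Taking e = 0 gives c_i = a_i and e = -1 gives
    c_i = -b_i, so that b_i = N_i'(0), an explicit product of factorials.  The
    remainder for u is then read off its Taylor expansion at the base point; the
    Taylor remainder of order p+1 is controlled by the oscillation of u^(p+1)
    (through the mean value inequality, X being a normed space), which is bounded
    on [0, T], and small on short intervals by uniform continuity. *)
Require Import Defs.
From HB Require Import structures.
From mathcomp Require Import all_boot all_order all_algebra.
From mathcomp Require Import all_classical all_reals all_analysis.
From mathcomp Require Import zify ring lra.

Set Implicit Arguments.
Unset Strict Implicit.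
Unset Printing Implicit Defensive.

Import Order.TTheory GRing.Theory Num.Theory.
Import numFieldNormedType.Exports.

Local Open Scope ring_scope.

(** * Finite difference operators *)

Lemma mu_add2 i : mu i.+2 = (mu i).+1.
Proof. by rewrite /mu -addn2 divnDr // addn1. Qed.

Lemma tau_add2 i : tau i.+2 = tau i.
Proof. by rewrite /tau -addn2 modnDr. Qed.

Lemma mu_ltn i : (0 < i)%N -> (mu i < i)%N.
Proof. by move=> i0; rewrite /mu ltn_Pdiv. Qed.

Section FiniteDifferenceTheory.
Context {R : realType} {X : normedModType R}.
Implicit Types (k x : R) (v w : R -> X) (g : R -> R).

Lemma Dminus_is_linear k : linear (Dminus k : (R -> X) -> (R -> X)).
Proof.
move=> c v w; apply/funext => x; rewrite /Dminus !fctE.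
rewrite opprD addrACA -scalerBr scalerDr; congr (_ + _).
by rewrite !scalerA mulrC.
Qed.

Lemma Dplus_is_linear k : linear (Dplus k : (R -> X) -> (R -> X)).
Proof.
move=> c v w; apply/funext => x; rewrite /Dplus !fctE.
rewrite opprD addrACA -scalerBr scalerDr; congr (_ + _).
by rewrite !scalerA mulrC.
Qed.

Lemma iter_linear (V : lmodType R) (f : V -> V) n : linear f -> linear (iter n f).
Proof. by move=> fl c v w; elim: n => //= n ->; exact: fl. Qed.

Lemma Dcomp_is_linear k i : linear (Dcomp k i : (R -> X) -> (R -> X)).
Proof.
have dd : linear (Dplus k \o Dminus k : (R -> X) -> (R -> X)).
  by move=> c v w /=; rewrite Dminus_is_linear Dplus_is_linear.
by move=> c v w; rewrite /Dcomp !iter_linear //; exact: Dminus_is_linear.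
Qed.

HB.instance Definition _ k i :=
  GRing.isLinear.Build R (R -> X) (R -> X) *:%R (Dcomp k i) (@Dcomp_is_linear k i).

Lemma DcompZ k i c v : Dcomp k i (c *: v) = c *: Dcomp k i v.
Proof. exact: linearZ. Qed.

Lemma Dcomp_add2 k i v : Dcomp k i.+2 v = Dcomp k i (Dplus k (Dminus k v)).
Proof. by rewrite /Dcomp mu_add2 tau_add2 iterSr. Qed.

(** Each difference quotient turns a bound [F] into [2 * F / k], and [i] of them are composed. The
    induction removes one pair [D_+ D_-], whose stencil widens the window by one node on each
    side. *)
Lemma Dcomp_bound k i v x E : 0 < k ->
  (forall y, x - (mu i + tau i)%:R * k <= y <= x + (mu i)%:R * k ->
     `|v y| <= E) ->
  k ^+ i * `|Dcomp k i v x| <= 2 ^+ i * E.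
Proof.
move=> k0.
have nk0 (z : X) : `|k^-1 *: z| = `|z| / k.
  by rewrite normrZ gtr0_norm ?invr_gt0 // mulrC.
have Dm (u : R -> X) z F : `|u z| <= F -> `|u (z - k)| <= F ->
    `|Dminus k u z| <= 2 * F / k.
  move=> H1 H2; rewrite /Dminus nk0 ler_pM2r ?invr_gt0//.
  by rewrite (le_trans (ler_normB _ _)) //; lra.
have Dp (u : R -> X) z F : `|u z| <= F -> `|u (z + k)| <= F ->
    `|Dplus k u z| <= 2 * F / k.
  move=> H1 H2; rewrite /Dplus nk0 ler_pM2r ?invr_gt0//.
  by rewrite (le_trans (ler_normB _ _)) //; lra.
elim/ltn_ind: i v E => -[|[|i]] IH v E.
- rewrite (_ : mu 0 = 0%N) // (_ : tau 0 = 0%N) // => H.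
  by rewrite /Dcomp /= expr0 !mul1r; apply: H; lra.
- rewrite (_ : mu 1 = 0%N) // (_ : tau 1 = 1%N) // => H.
  rewrite /Dcomp /= !expr1 -ler_pdivlMl // mulrC.
  by apply: Dm; apply: H; lra.
- rewrite Dcomp_add2 mu_add2 tau_add2 addSn.
  rewrite -[(mu i + tau i).+1%:R]natr1 -[(mu i).+1%:R]natr1 => H.
  have -> : 2 ^+ i.+2 * E = k ^+ 2 * (2 ^+ i * (2 * (2 * E / k) / k)).
    by rewrite !exprS; field; rewrite gt_eqF.
  rewrite -addn2 exprD mulrAC [leLHS]mulrC ler_pM2l ?exprn_gt0//.
  apply: IH => // y /andP[y1 y2].
  by apply: Dp; apply: Dm; apply: H; lra.
Qed.

End FiniteDifferenceTheory.

(** Each quotient of a function of [(z - x) / k] is again such a function, with a factor [k^-1].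
    Computations thus reduce to real functions, spacing [1] and base point [0]. *)
Lemma Dcomp_affine (R : realType) (X : normedModType R) (k x : R) i
    (g : R -> R) (w : X) y : k != 0 ->
  Dcomp k i (fun z => g ((z - x) / k) *: w) y =
  (k ^- i * Dcomp 1 i (g : R -> R^o) ((y - x) / k)) *: w.
Proof.
move=> k0.
have shD z : (z + k - x) / k = (z - x) / k + 1 by field.
have shB z : (z - k - x) / k = (z - x) / k - 1 by field.
have Dm h : Dminus k (fun z => h ((z - x) / k) *: w) =
    fun z => (k^-1 * (Dminus 1 (h : R -> R^o)) ((z - x) / k)) *: w.
  apply/funext => z; rewrite /Dminus shB -scalerBl scalerA; congr (_ *: _).
  by rewrite invr1 scale1r.
have Dp h : Dplus k (fun z => h ((z - x) / k) *: w) =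
    fun z => (k^-1 * (Dplus 1 (h : R -> R^o)) ((z - x) / k)) *: w.
  apply/funext => z; rewrite /Dplus shD -scalerBl scalerA; congr (_ *: _).
  by rewrite invr1 scale1r.
have DZ a i' h : Dcomp 1 i' ((fun z => a * h z) : R -> R^o) =
    fun z => a * Dcomp 1 i' (h : R -> R^o) z.
  exact: DcompZ.
elim/ltn_ind: i g y => -[|[|i]] IH g y.
- by rewrite /Dcomp /= expr0 invr1 mul1r.
- by rewrite /Dcomp /= Dm expr1.
- pose h z := k ^- 2 * Dplus 1 (Dminus 1 (g : R -> R^o)) z.
  have -> : Dcomp k i.+2 (fun z => g ((z - x) / k) *: w) =
      Dcomp k i (fun z => h ((z - x) / k) *: w).
    rewrite Dcomp_add2 Dm (Dp (fun z => k^-1 * Dminus 1 (g : R -> R^o) z)).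
    congr (Dcomp k i _); apply/funext => z; congr (_ *: _).
    by rewrite /h /Dplus -mulrBr -scalerAr mulrA -expr2 exprVn invr1 !scale1r.
  have -> := IH i (ltnW (ltnSn i.+1)) h y.
  by rewrite DZ Dcomp_add2 mulrA -invfM -exprD addn2.
Qed.

(** * The dual basis of Gauss polynomials *)

Section GaussBasis.
Context {R : realType}.
Implicit Types (x y : R) (f : {poly R}).

(** The roots are the [i] consecutive integers starting at [- mu i]; for [i > 0] they include [0],
    and the factored form gives the derivative there. *)
Definition gauss i : {poly R} :=
  (i`!)%:R^-1 *: \prod_(l < i) ('X - (l%:R - (mu i)%:R)%:P).

Definition binr i x : R := (\prod_(l < i) (x - l%:R)) / (i`!)%:R.

Lemma gauss0 : gauss 0 = 1.
Proof. by rewrite /gauss big_ord0 invr1 scale1r. Qed.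

Lemma gauss1 : gauss 1 = 'X.
Proof.
by rewrite /gauss big_ord_recl big_ord0 /= !subrr subr0 invr1 scale1r mulr1.
Qed.

Lemma horner_gauss i x : (gauss i).[x] = binr i (x + (mu i)%:R).
Proof.
rewrite /gauss /binr hornerZ horner_prod mulrC; congr (_ / _).
by apply: eq_bigr => l _; rewrite hornerXsubC opprB addrA.
Qed.

Lemma binr_nat_lt i n : (n < i)%N -> binr i n%:R = 0.
Proof.
by move=> ni; rewrite /binr (bigD1 (Ordinal ni)) //= subrr !mul0r.
Qed.

Lemma fact_neq0 n : (n`!)%:R != 0 :> R.
Proof. by rewrite pnatr_eq0 -lt0n fact_gt0. Qed.

(** The two products share the factors [x], ..., [x - i + 1]; the remaining ones, [x + 1] and
    [x - i], differ by [i + 1]. *)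
Lemma binr_pascal i x : binr i.+1 (x + 1) - binr i.+1 x = binr i x.
Proof.
rewrite /binr big_ord_recl [in X in _ - X]big_ord_recr /= subr0.
rewrite (eq_bigr (fun l : 'I_i => x - l%:R)); last first.
  by move=> l _; rewrite /bump leq0n add1n -natr1; ring.
set P := \prod_(_ < _) _; rewrite factS natrM.
have := fact_neq0 i; have : i.+1%:R != 0 :> R by rewrite pnatr_eq0.
by rewrite -natr1 => i0 f0; field; rewrite f0.
Qed.

Lemma gauss_at0 i : (gauss i).[0] = (i == 0%N)%:R.
Proof.
rewrite horner_gauss add0r; case: i => [|i].
  by rewrite /binr big_ord0 divff ?oner_eq0.
by rewrite binr_nat_lt // mu_ltn.
Qed.

(** This is [D_-] at [0], the odd base case of the duality; for [i >= 2] both [0] and [-1] are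
    roots. *)
Lemma gauss_back i : (gauss i).[0] - (gauss i).[-1] = (i == 1%N)%:R.
Proof.
case: i => [|[|i]]; rewrite !horner_gauss.
- by rewrite /binr !big_ord0 subrr.
- rewrite (_ : mu 1 = 0%N) // /binr !big_ord_recl !big_ord0 /=.
  by rewrite (_ : 1`! = 1%N) //; field.
- rewrite mu_add2 add0r (_ : -1 + _ = (mu i)%:R); last by rewrite -natr1; ring.
  have mi : ((mu i).+1 < i.+2)%N by rewrite -mu_add2 mu_ltn.
  by rewrite !binr_nat_lt ?subrr // ltnW.
Qed.

Lemma Dminus_unit (g : R -> R) x :
  Dminus 1 (g : R -> R^o) x = g x - g (x - 1) :> R.
Proof. by rewrite /Dminus invr1 scale1r. Qed.

Lemma Dplus_unit (g : R -> R) x :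
  Dplus 1 (g : R -> R^o) x = g (x + 1) - g x :> R.
Proof. by rewrite /Dplus invr1 scale1r. Qed.

Lemma Dcomp_gauss i j :
  Dcomp 1 i (fun x => (gauss j).[x] : R^o) 0 = (i == j)%:R :> R.
Proof.
elim/ltn_ind: i j => -[|[|i]] IH j.
- by rewrite /Dcomp /= gauss_at0 eq_sym.
- by rewrite /Dcomp /= Dminus_unit sub0r gauss_back eq_sym.
- rewrite Dcomp_add2.
  have D0 : (j < 2)%N ->
      Dplus 1 (Dminus 1 (fun x => (gauss j).[x] : R^o)) = 0.
    move=> j2; apply/funext => x; rewrite Dplus_unit !Dminus_unit.
    case: j j2 => [|[|//]] _; rewrite ?gauss0 ?gauss1 ?hornerC ?hornerX.
      by rewrite !subrr.
    by have : x + 1 - (x + 1 - 1) - (x - (x - 1)) = 0 by ring.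
  case: (ltnP j 2) => j2.
    by rewrite D0 // linear0 gtn_eqF // (leq_trans j2).
  case: j j2 {D0} => [|[|j]] // _.
  (* Pascal's rule, used for [D_-] and then for [D_+], lowers the degree by two;
     [mu (j + 2) = mu j + 1] aligns the arguments. *)
  rewrite !eqSS -IH //; congr (Dcomp _ _ _ _); apply/funext => x.
  rewrite Dplus_unit !Dminus_unit !horner_gauss mu_add2 -[(mu j).+1%:R]natr1.
  set m := (mu j)%:R.
  have shift y z n : z = y + 1 -> binr n.+1 z - binr n.+1 y = binr n y.
    by move=> ->; exact: binr_pascal.
  rewrite (shift (x - 1 + (m + 1))) ?(shift (x + 1 - 1 + (m + 1))); [|ring|ring].
  by rewrite shift; [congr (binr _ _); ring|ring].
Qed.

Lemma size_gauss i : size (gauss i) = i.+1.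
Proof.
rewrite size_scale ?invr_neq0 ?fact_neq0 //.
by rewrite size_prod_XsubC /index_enum -enumT size_enum_ord.
Qed.

Lemma lead_coef_gauss i : lead_coef (gauss i) = (i`!)%:R^-1.
Proof.
rewrite lead_coefZ (monicP _) ?mulr1 //.
exact: monic_prod_XsubC.
Qed.

(** As [gauss n] has degree [n], subtracting the multiple of it that cancels the coefficient of
    [X^n] lowers the size, and induction applies. *)
Lemma gauss_span (V : lmodType R) (L : {poly R} -> V) n : linear L ->
  (forall i, (i < n)%N -> L (gauss i) = 0) ->
  forall f, (size f <= n)%N -> L f = 0.
Proof.
move=> Llin; elim: n => [|n IH] L0 f sf.
  have /eqP -> : f == 0 by rewrite -size_poly_leq0.
  by have := Llin (-1) 0 0; rewrite !scaleN1r oppr0 addr0 addNr.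
pose c := f`_n * (n`!)%:R.
have {1}-> : f = c *: gauss n + (f - c *: gauss n).
  by rewrite addrC subrK.
rewrite Llin L0 // scaler0 add0r; apply: IH => [i ?|]; first by rewrite L0 // ltnW.
apply/leq_sizeP => j; rewrite leq_eqVlt => /predU1P[<-|nj].
  rewrite coefB coefZ -[X in _ * X]/((gauss n)`_(n.+1.-1)) -(size_gauss n).
  by rewrite -lead_coefE lead_coef_gauss mulfK ?fact_neq0 ?subrr.
rewrite coefB coefZ (nth_default _ (leq_trans sf nj)).
by rewrite [(gauss n)`_j]nth_default ?size_gauss // mulr0 subrr.
Qed.

(** * Coefficients of the formulas and exactness on polynomials *)

Definition ncoef (e : R) i : R :=
  (gauss i).[e + 1] - (gauss i).[e] - (gauss i)^`().[0].

Lemma ncoef_lt2 e i : (i < 2)%N -> ncoef e i = 0.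
Proof.
case: i => [|[|//]] _; rewrite /ncoef ?gauss0 ?gauss1.
  by rewrite !hornerE derivC hornerC; ring.
by rewrite !hornerE derivX hornerC; ring.
Qed.

(** Exact derivative minus approximation, at spacing [1] and base point [0]. *)
Definition defect e p f : R :=
  f^`().[0] - (f.[e + 1] - f.[e])
  + \sum_(2 <= i < p.+1) ncoef e i * Dcomp 1 i (fun x => f.[x] : R^o) 0.

Lemma defectP e p (c : R) f g :
  defect e p (c *: f + g) = c * defect e p f + defect e p g.
Proof.
have Dlin i : Dcomp 1 i (fun x => (c *: f + g).[x] : R^o) 0 =
    c * Dcomp 1 i (fun x => f.[x] : R^o) 0
    + Dcomp 1 i (fun x => g.[x] : R^o) 0 :> R.
  rewrite (_ : (fun x => _) = c *: (fun x => f.[x] : R^o) + (fun x => g.[x] : R^o)).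
    by rewrite Dcomp_is_linear.
  by apply/funext => x; rewrite hornerD hornerZ.
rewrite /defect derivD derivZ !(hornerD, hornerZ).
under eq_bigr do rewrite Dlin mulrDr mulrCA.
by rewrite big_split /= -mulr_sumr; ring.
Qed.

(** By duality only the term of index [i] can survive in the sum, and [ncoef e i] is chosen to
    cancel the rest. The index [p + 1] lies outside the sum, so its coefficient remains. *)
Lemma defect_gauss e p i : (i <= p.+1)%N ->
  defect e p (gauss i) = - (ncoef e i *+ (i == p.+1)).
Proof.
move=> ip; rewrite /defect.
under eq_bigr do rewrite Dcomp_gauss.
case: (ltnP i 2) => i2.
  rewrite big_nat big1 => [|j /andP[j2 _]]; last first.
    by rewrite gtn_eqF ?mulr0 // (leq_trans i2).
  have c0 := ncoef_lt2 e i2; rewrite c0 mul0rn.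
  by move: c0; rewrite /ncoef; lra.
rewrite big_nat; have [->|/eqP ni] := eqVneq i p.+1.
  rewrite big1 => [|j /andP[_ jp]]; last by rewrite ltn_eqF ?mulr0.
  by rewrite /ncoef mulr1n; ring.
have ip' : (i < p.+1)%N by rewrite ltn_neqAle ip andbT; apply/eqP.
rewrite -big_nat (bigD1_seq i) ?iota_uniq ?mem_index_iota ?i2//=.
rewrite eqxx mulr1 big1 ?addr0 => [|j /negPf ->]; last by rewrite mulr0.
by rewrite /ncoef mulr0n; ring.
Qed.

Lemma defect_small e p f : (size f <= p.+1)%N -> defect e p f = 0.
Proof.
have dlin : linear (defect e p : {poly R} -> R^o) by exact: defectP.
apply: (gauss_span dlin) => i ip.
by rewrite defect_gauss 1?ltnW // ltn_eqF ?mulr0n ?oppr0.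
Qed.

(** For [j = p + 1] the monomial and [gauss p.+1] have the same leading coefficient, so they differ
    by a polynomial of degree at most [p], where the defect vanishes. *)
Lemma defect_monomial e p j : (j <= p.+1)%N ->
  defect e p ((j`!)%:R^-1 *: 'X^j) = - (ncoef e j *+ (j == p.+1)).
Proof.
rewrite leq_eqVlt => /predU1P[->|jp]; last first.
  rewrite defect_small ?ltn_eqF ?mulr0n ?oppr0 //.
  by rewrite (leq_trans (size_scale_leq _ _)) // size_polyXn.
rewrite -defect_gauss // -[in LHS](subrK (gauss p.+1) (_ *: _)).
rewrite -[X in defect e p (X + _)]scale1r defectP mul1r.
rewrite defect_small ?add0r //.
apply/leq_sizeP => i; rewrite leq_eqVlt => /predU1P[<-|nj].
  rewrite coefB coefZ coefXn eqxx mulr1 -[X in _ - X]/((gauss p.+1)`_(p.+2.-1)).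
  by rewrite -(size_gauss p.+1) -lead_coefE lead_coef_gauss subrr.
by rewrite coefB coefZ coefXn gtn_eqF // mulr0 nth_default ?subrr ?size_gauss.
Qed.

(** * Closed form of the coefficients *)

Lemma natr_fact n : (n`!)%:R = \prod_(i < n) (i.+1)%:R :> R.
Proof. by rewrite fact_prod big_add1 /= big_mkord natr_prod. Qed.

(** At the simple root [0] the derivative is the product of the other factors: the roots [-m], ...,
    [-1] give [m!] and the roots [1], ..., [r] give [(-1)^r r!]. *)
Lemma deriv_gauss_at0 m r : mu (m + r.+1) = m ->
  (gauss (m + r.+1))^`().[0] =
  (-1) ^+ r * (m`!)%:R * (r`!)%:R / ((m + r.+1)`!)%:R.
Proof.
move=> mE; rewrite /gauss mE big_split_ord big_ord_recl /= addn0 subrr subr0.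
set P := \prod_(i < m) _; set Q := \prod_(i < r) _.
have P0 : P.[0] = (m`!)%:R.
  rewrite /P horner_prod natr_fact (reindex_inj rev_ord_inj).
  apply: eq_bigr => i _; rewrite hornerXsubC /= natrB //; ring.
have Q0 : Q.[0] = (-1) ^+ r * (r`!)%:R.
  rewrite /Q horner_prod natr_fact -[in (-1) ^+ r](card_ord r) -prodrN.
  apply: eq_bigr => i _; rewrite hornerXsubC /= /bump leq0n add1n natrD; ring.
rewrite derivZ !derivM derivX !(hornerZ, hornerD, hornerM, hornerX) P0 Q0 hornerC.
ring.
Qed.

Definition bcoef i : R := (gauss i)^`().[0].

Definition acoef i : R := (i == 2%N)%:R - bcoef i.

Lemma ncoefN1 i : (1 < i)%N -> ncoef (-1) i = - bcoef i.
Proof.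
by move=> i1; rewrite /ncoef addNr gauss_back gtn_eqF // sub0r.
Qed.

(** For [i >= 2] the backward difference at [0] vanishes, so the forward one equals [D_+ D_-] at
    [0], which duality evaluates to the indicator of [i = 2]. This indicator is what makes [i = 2]
    the exception to [a_i = - b_i]. *)
Lemma ncoef0 i : (1 < i)%N -> ncoef 0 i = acoef i.
Proof.
move=> i1; rewrite /ncoef /acoef add0r -/(bcoef i); congr (_ - _).
have := Dcomp_gauss 2 i; rewrite eq_sym => <-.
rewrite Dcomp_add2 /Dcomp /= Dplus_unit !Dminus_unit add0r subrr sub0r.
by rewrite gauss_back gtn_eqF // subr0.
Qed.

Lemma bcoef2 : bcoef 2 = 1 / 2.
Proof. by rewrite /bcoef (deriv_gauss_at0 (m := 1) (r := 0)) // !mul1r. Qed.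

Lemma acoef2 : acoef 2 = 1 / 2.
Proof. by rewrite /acoef bcoef2 eqxx /=; field. Qed.

Lemma acoef_ge3 i : (2 < i)%N -> acoef i = - bcoef i.
Proof. by move=> i2; rewrite /acoef gtn_eqF // sub0r. Qed.

Lemma acoefE m r : (2 < m + r.+1)%N -> mu (m + r.+1) = m ->
  acoef (m + r.+1) = (-1) ^+ r.+1 * ((m`!)%:R * (r`!)%:R / ((m + r.+1)`!)%:R).
Proof.
move=> i2 mE; rewrite acoef_ge3 // /bcoef deriv_gauss_at0 //.
by rewrite exprS !mulN1r !mulNr !mulrA.
Qed.

End GaussBasis.

Lemma acoef_values (R : realType) (a : nat -> R := acoef) :
    a 3%N = 1 / (3`!)%:R /\
    a 4%N = 2 / (4`!)%:R /\
    a 5%N = - (4 / (5`!)%:R) /\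
    a 6%N = - (12 / (6`!)%:R) /\
    a 7%N = 36 / (7`!)%:R /\
    a 8%N = 144 / (8`!)%:R /\
    a 9%N = - (576 / (9`!)%:R) /\
    a 10%N = - (2880 / (10`!)%:R) /\
    a 11%N = 14400 / (11`!)%:R.
Proof.
(* Here [r = m - 1] for even [n] and [r = m] for odd [n]. *)
have E m r n c : (n = m + r.+1)%N -> (2 < m + r.+1)%N -> mu (m + r.+1) = m ->
    (m`!)%:R * (r`!)%:R = c :> R ->
    a n = (-1) ^+ r.+1 * (c / (n`!)%:R).
  by move=> -> i2 mE <-; rewrite /a acoefE.
have f2 : 2`! = 2 by []. have f3 : 3`! = 6 by [].
have f4 : 4`! = 24 by []. have f5 : 5`! = 120 by [].
rewrite (E 1%N 1%N 3%N 1) ?mulr1 //.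
rewrite (E 2%N 1%N 4%N 2) ?f2 ?mulr1 //.
rewrite (E 2%N 2%N 5%N 4) ?f2 //; last by ring.
rewrite (E 3%N 2%N 6%N 12) ?f3 ?f2 //; last by ring.
rewrite (E 3%N 3%N 7%N 36) ?f3 //; last by ring.
rewrite (E 4%N 3%N 8%N 144) ?f4 ?f3 //; last by ring.
rewrite (E 4%N 4%N 9%N 576) ?f4 //; last by ring.
rewrite (E 5%N 4%N 10%N 2880) ?f5 ?f4 //; last by ring.
rewrite (E 5%N 5%N 11%N 14400) ?f5 //; last by ring.
by do !split; rewrite !exprS expr0; ring.
Qed.

(** * Mean value inequality and Taylor expansion *)

Section DerivativeWithin.
Local Open Scope classical_set_scope.
Context {R : realType} {X : normedModType R}.
Implicit Types (A : set R) (f g : R -> X) (x y : R) (l : X).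

Lemma diff_quot_withinP A f x l : diff_quot_within A f x --> l ->
  forall e, 0 < e -> exists2 d, 0 < d & forall y, A y -> `|y - x| < d ->
    `|f y - f x - (y - x) *: l| <= e * `|y - x|.
Proof.
move=> /cvgrPdist_le fl e e0; have := fl e e0.
rewrite /diff_quot_within /within /= => /nbhs_ballP[d /= d0 H].
exists d => // y Ay yx; have [->|yx0] := eqVneq y x.
  by rewrite !subrr scale0r subrr !normr0 mulr0.
have h0 : y - x != 0 by rewrite subr_eq0.
have := H (y - x); rewrite /ball /= sub0r normrN => /(_ yx h0).
rewrite addrC subrK => /(_ Ay).
rewrite -(ler_pM2r (_ : 0 < `|y - x|)) ?normr_gt0 // mulrC -normrZ.
by rewrite scalerBr scalerA divff // scale1r distrC.
Qed.

Lemma diff_quot_withinD A f g x l l' :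
  diff_quot_within A f x --> l -> diff_quot_within A g x --> l' ->
  diff_quot_within A (fun y => f y + g y) x --> l + l'.
Proof.
move=> fl gl; rewrite /diff_quot_within.
under eq_fun do rewrite opprD addrACA scalerDr.
exact: cvgD.
Qed.

Lemma diff_quot_withinN A f x l :
  diff_quot_within A f x --> l -> diff_quot_within A (fun y => - f y) x --> - l.
Proof.
move=> fl; rewrite /diff_quot_within.
under eq_fun do rewrite -opprD scalerN.
exact: cvgN.
Qed.

Lemma diff_quot_within_cst A c x : diff_quot_within A (fun=> c : X) x --> 0.
Proof.
rewrite /diff_quot_within; under eq_fun do rewrite subrr scaler0.
exact: cvg_cst.
Qed.

Lemma diff_quot_within_scalel A (g : R -> R) (c : X) x (dg : R) :
  is_derive x 1 g dg -> diff_quot_within A (fun y => g y *: c) x --> dg *: c.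
Proof.
move=> [gx dgE].
have {gx} gx : h^-1 *: (g (x + h) - g x) @[h --> 0^'] --> dg.
  rewrite -dgE; move: gx; rewrite /derivable /derive.
  rewrite (_ : (fun h => _) = (fun h => h^-1 *: (g (x + h) - g x))).
    by move=> cg; exact: cg.
  by apply/funext => h; rewrite /= [h%:A]mulr1 (addrC h).
rewrite /diff_quot_within.
under eq_fun do rewrite -scalerBl scalerA.
apply: cvgZr_tmp.
exact: (cvg_within_filter [set h | A (x + h)] gx).
Qed.

Lemma is_derive_monomial (c x : R) n :
  is_derive x 1 (fun y => (y - c) ^+ n.+1 / (n.+1`!)%:R : R)
    ((x - c) ^+ n / (n`!)%:R).
Proof.
rewrite (_ : (fun y => _) = (n.+1`!)%:R^-1 *: (fun y : R => y - c) ^+ n.+1);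
  last first.
  by apply/funext => y; rewrite !fctE mulrC.
apply: is_derive_eq.
rewrite /GRing.scale /= factS natrM; field.
by rewrite fact_neq0 nat1r pnatr_eq0.
Qed.

(** Termwise differentiation lowers each power and shifts the coefficients, so the Taylor remainder
    of [u] differentiates to that of [u']. *)
Lemma diff_quot_within_taylor A (u : nat -> X) c x n :
  diff_quot_within A
    (fun y => \sum_(j < n.+1) ((y - c) ^+ j / (j`!)%:R) *: u j) x -->
  \sum_(j < n) ((x - c) ^+ j / (j`!)%:R) *: u j.+1.
Proof.
elim: n => [|n IH].
  rewrite big_ord0; under [X in diff_quot_within _ X]eq_fun do
    rewrite big_ord_recl big_ord0 addr0 expr0.
  exact: diff_quot_within_cst.
rewrite big_ord_recr /=; under [X in diff_quot_within _ X]eq_fun do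
  rewrite big_ord_recr /=.
by apply: diff_quot_withinD => //; exact/diff_quot_within_scalel/is_derive_monomial.
Qed.

Lemma mean_value_inequality f df a b M : a <= b ->
  (forall x, a <= x <= b -> diff_quot_within `[a, b] f x --> df x) ->
  (forall x, a <= x <= b -> `|df x| <= M) ->
  `|f b - f a| <= M * (b - a).
Proof.
move=> ab fdf dfM.
apply/ler_addgt0Pr => e' e'0.
(* Chosen so that [e * (b - a) <= e']; the [+ 1] keeps the denominator positive when [a = b]. *)
pose e := e' / (b - a + 1).
have e0 : 0 < e by rewrite divr_gt0 //; lra.
suff : `|f b - f a| <= (M + e) * (b - a).
  move=> /le_trans; apply; rewrite mulrDl lerD2l /e mulrAC ler_pdivrMr; last lra.
  by rewrite ler_pM2l//; lra.
(* The estimate with M + e persists up to and beyond the supremum s of the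
   points where it holds, unless s = b. *)
pose S := [set x | a <= x <= b /\ `|f x - f a| <= (M + e) * (x - a)].
have Sa : S a by split; [rewrite lexx ab | rewrite !subrr normr0 mulr0].
have hsS : has_sup S by split; [exists a | exists b => x [/andP[]]].
set s := sup S.
have as_ : a <= s by apply: ub_le_sup => //; exact: hsS.2.
have sb : s <= b by apply: ge_sup => [|x [/andP[]]]; first exact: hsS.1.
have sab : a <= s <= b by rewrite as_ sb.
have [d d0 fs] := diff_quot_withinP (fdf s sab) e0.
have loc y : a <= y <= b -> `|y - s| < d -> `|f y - f s| <= (M + e) * `|y - s|.
  move=> yab ys; have := fs y; rewrite /= in_itv /= => /(_ yab ys) H.
  rewrite -[f y - f s](subrK ((y - s) *: df s)) (le_trans (ler_normD _ _)) //.
  rewrite mulrDl addrC lerD // normrZ mulrC ler_wpM2r //; exact: dfM.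
have Ss : S s.
  split=> //; have [x [xab Sx] sx] := sup_adherent d0 hsS.
  have xs : x <= s by apply: ub_le_sup => //; exact: hsS.2.
  have nxs : `|x - s| = s - x by rewrite distrC ger0_norm // subr_ge0.
  have := loc x xab; rewrite nxs distrC => /(_ ltac:(rewrite /s; lra)) H.
  rewrite -[f s - f a](subrKA (f x)) (le_trans (ler_normD _ _)) // addrC.
  have -> : (M + e) * (s - a) = (M + e) * (x - a) + (M + e) * (s - x) by ring.
  exact: lerD.
have [sb'|bs] := ltP s b; last first.
  have -> : b = s by apply/le_anti; rewrite bs sb.
  exact: Ss.2.
pose y := Num.min (s + d / 2) b.
have sy : s < y by rewrite /y lt_min sb' andbT; lra.
have yb : y <= b by rewrite /y ge_min lexx orbT.
have ysd : y <= s + d / 2 by rewrite /y ge_min lexx.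
have yd : y - s < d by lra.
have yab : a <= y <= b by rewrite yb andbT; lra.
have nys : `|y - s| = y - s by rewrite gtr0_norm // subr_gt0.
suff /(ub_le_sup hsS.2) : S y by rewrite leNgt sy.
split=> //; rewrite -[f y - f a](subrKA (f s)) (le_trans (ler_normD _ _)) // addrC.
have -> : (M + e) * (y - a) = (M + e) * (s - a) + (M + e) * (y - s) by ring.
by rewrite lerD //; [exact: Ss.2 | rewrite -[X in _ * X]nys loc // nys].
Qed.

End DerivativeWithin.

Section Taylor.
Local Open Scope classical_set_scope.
Context {R : realType} {X : normedModType R}.
Implicit Types (a b x y : R) (u : R -> X).

(** Allows the mean value inequality on a subsegment while derivatives are taken within the whole
    segment. *)
Lemma diff_quot_within_sub (A B : set R) u x (l : X) : A `<=` B ->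
  diff_quot_within B u x --> l -> diff_quot_within A u x --> l.
Proof.
move=> AB; apply: cvg_trans; apply: cvg_fmap2.
move=> P; rewrite /within /= /nbhs /=; apply: filterS => h /= HP /AB.
exact: HP.
Qed.

Lemma derive_within_nS (A : set R) j u :
  derive_within_n A j.+1 u = derive_within_n A j (derive_within A u).
Proof. exact: iterSr. Qed.

(** Induction on [m], applied to [u']: the remainder vanishes at [x] and its derivative is the
    remainder of [u'], so the mean value inequality adds a factor [|y - x|]. The polynomial includes
    degree [m], hence only the oscillation of the [m]-th derivative enters. *)
Lemma taylor_within a b m u d e :
  (forall j x, (j < m)%N -> a <= x <= b ->
    derivable_within `[a, b] (derive_within_n `[a, b] j u) x) ->
  (forall x y, a <= x <= b -> a <= y <= b -> `|y - x| < d ->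
    `|derive_within_n `[a, b] m u y - derive_within_n `[a, b] m u x| <= e) ->
  forall x y, a <= x <= b -> a <= y <= b -> `|y - x| < d ->
    `|u y - \sum_(j < m.+1) ((y - x) ^+ j / (j`!)%:R)
                *: derive_within_n `[a, b] j u x|
      <= e * `|y - x| ^+ m.
Proof.
elim: m u => [|m IH] u du unif x y xab yab yx.
  by rewrite big_ord_recl big_ord0 !expr0 divr1 scale1r addr0 mulr1 unif.
have {}IH s : a <= s <= b -> `|s - x| < d ->
    `|derive_within `[a, b] u s - \sum_(j < m.+1) ((s - x) ^+ j / (j`!)%:R) *:
       derive_within_n `[a, b] j (derive_within `[a, b] u) x| <= e * `|s - x| ^+ m.
  apply: IH => // [j z jm zab|z1 z2].
  - by rewrite -derive_within_nS; exact: du.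
  - by rewrite -derive_within_nS; exact: unif.
pose U j := derive_within_n `[a, b] j u x.
pose g s := u s - \sum_(j < m.+2) ((s - x) ^+ j / (j`!)%:R) *: U j.
pose dg s := derive_within `[a, b] u s
  - \sum_(j < m.+1) ((s - x) ^+ j / (j`!)%:R) *: U j.+1.
have dgP s : a <= s <= b -> diff_quot_within `[a, b] g s --> dg s.
  move=> sab; apply: diff_quot_withinD; first exact: (du 0%N).
  exact/diff_quot_withinN/diff_quot_within_taylor.
have gx : g x = 0.
  rewrite /g big_ord_recl big1 => [|j _].
    by rewrite subrr expr0 divr1 scale1r addr0 /U /= subrr.
  by rewrite subrr expr0n mul0r scale0r.
have dgM s : a <= s <= b -> `|s - x| <= `|y - x| -> `|dg s| <= e * `|y - x| ^+ m.
  move=> sab sx; have sd := le_lt_trans sx yx.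
  (* The oscillation bound at the pair [(x, x)] reads [0 <= e]. *)
  have e0 : 0 <= e.
    apply: le_trans (unif x x xab xab _); rewrite ?subrr ?normr0 //.
    exact: le_lt_trans yx.
  rewrite /dg /U; under eq_bigr do rewrite derive_within_nS.
  by apply: le_trans (IH s sab sd) _; rewrite ler_wpM2l // lerXn2r ?nnegrE.
(* Stated for ordered endpoints, to serve both [x <= y] and [y < x]. *)
have key lo hi : lo <= hi -> a <= lo -> hi <= b ->
    (forall s, lo <= s <= hi -> `|s - x| <= `|y - x|) ->
    `|g hi - g lo| <= e * `|y - x| ^+ m * (hi - lo).
  move=> lh al hb near_x; apply: (@mean_value_inequality _ _ _ dg) => // s slh.
    apply: diff_quot_within_sub (dgP s _); last by lra.
    by move=> z /=; rewrite !in_itv /=; lra.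
  by apply: dgM (near_x s slh); lra.
rewrite -/(g y) -[g y]subr0 -gx exprSr mulrA.
have [xy|yx'] := leP x y.
  rewrite ger0_norm ?subr_ge0 //.
  rewrite -{1}(ger0_norm (_ : 0 <= y - x)) ?subr_ge0 //.
  apply: key => // [||s /andP[xs sy]]; [lra|lra|].
  by rewrite !ger0_norm ?subr_ge0 // lerB.
rewrite distrC [X in _ * X](_ : _ = x - y); last first.
  by rewrite distrC gtr0_norm // subr_gt0.
apply: key => // [||| s /andP[ys sx]]; [exact: ltW|lra|lra|].
by rewrite !(distrC _ x) !ger0_norm ?subr_ge0 ?lerB // ltW.
Qed.

(** Compactness, as a near-covering property, turns a radius valid near each point into one valid on
    the whole segment. *)
Lemma segment_unif_continuous a b u : {within `[a, b], continuous u} ->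
  forall e, 0 < e -> exists2 d, 0 < d &
    forall x y, a <= x <= b -> a <= y <= b -> `|y - x| < d -> `|u y - u x| <= e.
Proof.
move=> cu e e0.
have := @segment_compact R a b => /compact_near_coveringP/near_covering_withinP cov.
pose P (d x : R) := forall y, a <= y <= b -> `|y - x| < d -> `|u y - u x| <= e.
have /(cov _ 0^'+ P) : forall x, `[a, b]%classic x ->
    \forall x' \near x & d \near 0^'+, `[a, b]%classic x' -> P d x'.
  move=> x xab; have := (subspace_continuousP _ _).1 cu x xab.
  move=> /cvgrPdist_le/(_ (e / 2)); rewrite divr_gt0 // => /(_ isT).
  rewrite /within /= => /nbhs_ballP[d /= d0 H].
  have d20 : 0 < d / 2 by rewrite divr_gt0.
  have loc z : a <= z <= b -> `|x - z| < d -> `|u x - u z| <= e / 2.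
    by move=> zab xz; apply: H => //=; rewrite in_itv.
  (* Halving [d] places both [x'] and [y] within [d] of [x]. *)
  exists (ball x (d / 2), [set r | r < d / 2]).
    split; first exact: nbhsx_ballx.
    exact: nbhs_right_lt.
  move=> -[x' r] /= [xx' rd]; rewrite in_itv /= => x'ab y yab yx'.
  rewrite -[u y - u x'](subrKA (u x)) (le_trans (ler_normD _ _)) //.
  rewrite [leRHS](splitr e) lerD // ?(distrC (u y)) loc //.
  - rewrite -(subrKA x') (le_lt_trans (ler_normD _ _)) // (splitr d).
    by rewrite ltrD // distrC (lt_trans yx').
  - by rewrite (lt_trans xx') // ltr_pdivrMr // ltr_pMr // ltr1n.
move=> /filterI/(_ (nbhs_right_gt 0))/filter_ex[d [Pd d0]].
by exists d => // x y xab; apply: (Pd x); rewrite /= in_itv.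
Qed.

Lemma segment_bounded a b u : {within `[a, b], continuous u} ->
  exists2 M, 0 < M & forall x, a <= x <= b -> `|u x| <= M.
Proof.
move=> cu; have := continuous_compact cu (@segment_compact R a b).
move=> /compact_bounded[M [_ HM]].
exists (`|M| + 1) => [|x xab]; first by rewrite ltr_pwDr.
apply: (HM (`|M| + 1)); first by rewrite (le_lt_trans (ler_norm M)) // ltrDl.
by exists x => //=; rewrite in_itv.
Qed.

End Taylor.

(** * Remainders *)

Section RemainderEstimate.
Local Open Scope classical_set_scope.
Context {R : realType} {X : normedModType R}.
Implicit Types (e k t : R) (u v w : R -> X).

(* [k] times the approximation of u'(t): [e = 0] is the first formula with
   t = t_n, [e = -1] the second one with t = t_(n+1). *)
Definition scaled_approx e p k t v : X :=
  v (t + (e + 1) * k) - v (t + e * k)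
  - \sum_(2 <= i < p.+1) (ncoef e i * k ^+ i) *: Dcomp k i v t.

Lemma scaled_approx_is_linear e p k t : linear (scaled_approx e p k t).
Proof.
move=> c v w; rewrite /scaled_approx.
have Dlin i : (ncoef e i * k ^+ i) *: Dcomp k i (c *: v + w) t =
    c *: ((ncoef e i * k ^+ i) *: Dcomp k i v t)
    + (ncoef e i * k ^+ i) *: Dcomp k i w t.
  by rewrite Dcomp_is_linear scalerDr !scalerA [c * _]mulrC.
under eq_bigr do rewrite Dlin.
rewrite big_split /= -scaler_sumr !fctE !scalerBr.
by rewrite !opprD [X in X + _ = _]addrACA [LHS]addrACA.
Qed.

HB.instance Definition _ e p k t :=
  GRing.isLinear.Build R (R -> X) X *:%R (scaled_approx e p k t)
    (@scaled_approx_is_linear e p k t).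

(** After rescaling, the weights [k^i] cancel the factors [k^-i] of the difference operators,
    leaving the unit-spacing approximation of [f'(0)]. *)
Lemma scaled_approx_poly e p k t (f : {poly R}) (c : X) : k != 0 ->
  scaled_approx e p k t (fun y => f.[(y - t) / k] *: c) =
  (f^`().[0] - defect e p f) *: c.
Proof.
move=> k0; rewrite /scaled_approx.
have -> : (t + (e + 1) * k - t) / k = e + 1 by field.
have -> : (t + e * k - t) / k = e by field.
have Dc i : (ncoef e i * k ^+ i) *: Dcomp k i (fun y => f.[(y - t) / k] *: c) t =
    (ncoef e i * Dcomp 1 i (fun x => f.[x] : R^o) 0 : R) *: c.
  rewrite (Dcomp_affine t i (horner f)) // subrr mul0r scalerA mulrA.
  by rewrite mulfK ?expf_neq0.
under eq_bigr do rewrite Dc.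
rewrite -scaler_suml -!scalerBl; congr (_ *: _).
by rewrite /defect; ring.
Qed.

(** The first factor bounds the scaled approximation of a function of size [1]; the power of [p]
    comes from all nodes lying within [p * k] of the base point. *)
Definition remainder_const e p : R :=
  (2 + \sum_(2 <= i < p.+1) `|ncoef e i| * 2 ^+ i) * p%:R ^+ p.+1.

Lemma scaled_approx_bound e p k t v E : 0 < k -> -1 <= e <= 0 ->
  (forall y, t - (mu p + tau p)%:R * k <= y <= t + (mu p)%:R * k -> `|v y| <= E) ->
  `|v (t + (e + 1) * k)| <= E -> `|v (t + e * k)| <= E ->
  `|scaled_approx e p k t v|
    <= (2 + \sum_(2 <= i < p.+1) `|ncoef e i| * 2 ^+ i) * E.
Proof.
move=> k0 e01 vE v1 v0; rewrite mulrDl (le_trans (ler_normB _ _)) // lerD //.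
  by rewrite (le_trans (ler_normB _ _)) //; lra.
rewrite mulr_suml !big_nat (le_trans (ler_norm_sum _ _ _)) // ler_sum //.
move=> i /andP[_ ip].
rewrite normrZ normrM (gtr0_norm (exprn_gt0 _ k0)) -!mulrA ler_wpM2l //.
apply: Dcomp_bound => // y /andP[y1 y2]; apply: vE.
have mle : (mu i <= mu p)%N by rewrite leq_div2r.
(* Although [tau] is not monotone, [mu i + tau i] is [i / 2] rounded up, which is. *)
have tle : (mu i + tau i <= mu p + tau p)%N.
  by move: ip; rewrite /mu /tau; lia.
have kmul m n : (m <= n)%N -> m%:R * k <= n%:R * k.
  by move=> mn; rewrite ler_wpM2r ?ler_nat // ltW.
have := kmul _ _ mle; have := kmul _ _ tle; lra.
Qed.

(** Split [u] into its Taylor polynomial of degree [p + 1] and a rest [r]. Among the monomials only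
    degree [1], giving the derivative, and degree [p + 1], giving the error term, contribute; [r] is
    bounded at the nodes. *)
Lemma remainder_estimate e p k t d E (U : nat -> X) u : (0 < p)%N -> 0 < k ->
  -1 <= e <= 0 -> p%:R * k < d -> 0 <= E ->
  (forall y, (t - (mu p + tau p)%:R * k <= y <= t + (mu p)%:R * k) \/
      y = t + (e + 1) * k \/ y = t + e * k ->
    `|y - t| < d ->
    `|u y - \sum_(j < p.+2) ((y - t) ^+ j / (j`!)%:R) *: U j|
      <= E * `|y - t| ^+ p.+1) ->
  `|U 1%N - k^-1 *: scaled_approx e p k t u + (ncoef e p.+1 * k ^+ p) *: U p.+1|
    <= remainder_const e p * E * k ^+ p.
Proof.
move=> p0 k0 e01 kd E0 taylor; have kn0 : k != 0 by rewrite gt_eqF.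
pose f j : {poly R} := (j`!)%:R^-1 *: 'X^j.
(* The [j]-th Taylor term as a polynomial in [(y - t) / k], with the factor [k^j] moved to the
   vector. *)
pose T j := fun y => (f j).[(y - t) / k] *: (k ^+ j *: U j).
pose r y := u y - \sum_(j < p.+2) ((y - t) ^+ j / (j`!)%:R) *: U j.
have uE : u = \sum_(j < p.+2) T j + r.
  apply/funext => y; rewrite fctE fct_sumE /r addrC.
  rewrite -[LHS](subrK (\sum_(j < p.+2) T j y)).
  congr (_ - _ + _); apply: eq_bigr => j _.
  rewrite /T /f hornerZ hornerXn scalerA exprMn exprVn; congr (_ *: _).
  by field; rewrite fact_neq0 expf_neq0.
have TE j : (j <= p.+1)%N -> scaled_approx e p k t (T j) =
    ((j == 1%N)%:R * k ^+ j + (ncoef e j *+ (j == p.+1)) * k ^+ j) *: U j.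
  move=> jp; rewrite /T scaled_approx_poly // defect_monomial // opprK.
  rewrite scalerA -mulrDl.
  congr (_ * _ *: _); congr (_ + _).
  rewrite derivZ derivXn hornerZ hornerMn hornerXn.
  case: j {jp} => [|[|j]]; rewrite ?mulr0n ?mulr0 //.
    by rewrite expr0 mulr1n mulr1 invr1.
  by rewrite /= expr0n mul0rn mulr0.
have -> : scaled_approx e p k t u =
    k *: U 1%N + (ncoef e p.+1 * k ^+ p.+1) *: U p.+1 + scaled_approx e p k t r.
  rewrite uE linearD linear_sum /=; congr (_ + _).
  under eq_bigr => j _ do rewrite TE ?leq_ord // scalerDl.
  rewrite big_split /=; congr (_ + _).
    rewrite (bigD1 (inord 1)) //= inordK // eqxx mul1r expr1 big1 ?addr0 // => j.
    by rewrite -val_eqE /= inordK // => /negPf ->; rewrite mul0r scale0r.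
  rewrite (bigD1 ord_max) //= eqxx mulr1n big1 ?addr0 // => j.
  by rewrite -val_eqE /= => /negPf ->; rewrite mul0r scale0r.
have rE y : (t - (mu p + tau p)%:R * k <= y <= t + (mu p)%:R * k) \/
      y = t + (e + 1) * k \/ y = t + e * k -> `|r y| <= E * (p%:R * k) ^+ p.+1.
  move=> yt.
  have kp (m : R) : m <= p%:R -> m * k <= p%:R * k.
    by move=> mp; rewrite ler_wpM2r // ltW.
  have yp : `|y - t| <= p%:R * k.
    have p1 : 1 <= p%:R :> R by rewrite ler1n.
    have := kp 1 p1; have := kp (- e); have := kp (e + 1).
    have := kp (mu p + tau p)%:R; have := kp (mu p)%:R; rewrite !ler_nat.
    have -> : (mu p <= p)%N by rewrite /mu; lia.
    have -> : (mu p + tau p <= p)%N by rewrite /mu /tau; lia.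
    move=> /(_ isT) h1 /(_ isT) h2 h3 h4 h5.
    have {}h3 := h3 ltac:(lra); have {}h4 := h4 ltac:(lra).
    have k1 : 0 <= (e + 1) * k by apply: mulr_ge0; lra.
    have k2 : 0 <= (- e) * k by apply: mulr_ge0; lra.
    by rewrite ler_norml; case: yt => [|[->|->]]; lra.
  apply: le_trans (taylor y yt (le_lt_trans yp kd)) _.
  by rewrite ler_wpM2l // lerXn2r ?nnegrE // mulr_ge0 ?ler0n // ltW.
have := scaled_approx_bound k0 e01 (fun y yt => rE y (or_introl yt))
   (rE _ (or_intror (or_introl erefl)))
  (rE _ (or_intror (or_intror erefl))).
move: (scaled_approx e p k t r) => Q; rewrite exprMn.
(* Both polynomial contributions cancel exactly; dividing [Q] by [k] leaves order [p]. *)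
have -> : U 1%N - k^-1 *: (k *: U 1%N + (ncoef e p.+1 * k ^+ p.+1) *: U p.+1 + Q)
    + (ncoef e p.+1 * k ^+ p) *: U p.+1 = - (k^-1 *: Q).
  rewrite !scalerDr !scalerA mulVf // scale1r.
  rewrite (_ : k^-1 * _ = ncoef e p.+1 * k ^+ p); last by rewrite exprS; field.
  by rewrite !opprD !addrA subrr sub0r [LHS]addrAC addNr add0r.
rewrite normrN normrZ gtr0_norm ?invr_gt0 // ler_pdivrMl // => /le_trans; apply.
rewrite le_eqVlt; apply/orP; left; apply/eqP.
by rewrite /remainder_const [k ^+ p.+1]exprS; ring.
Qed.

End RemainderEstimate.

(** * Order and error constant of the two formulas *)

Section Approximations.
Context {R : realType} {X : normedModType R}.
Implicit Types (e k : R) (u : R -> X).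

Lemma remainder_const_ge0 e p : 0 <= remainder_const e p.
Proof.
by rewrite mulr_ge0 ?exprn_ge0 // addr_ge0 // sumr_ge0.
Qed.

(** Both claims follow from one estimate [est] in terms of the oscillation of [u^(p+1)]. The points
    [t + e k] and [t + (e + 1) k] are located separately, since for [p = 1] the difference stencil
    need not contain them. *)
Lemma approx_order_error_constant e p (formula : R -> (R -> X) -> nat -> X)
    (adm : nat -> nat -> bool) (pt : nat -> nat) (C : R) (s : bool) :
  (0 < p)%N -> -1 <= e <= 0 ->
  (forall k u n, 0 < k ->
    formula k u n = k^-1 *: scaled_approx e p k (node k (pt n)) u) ->
  (forall N n, adm N n -> (mu p + tau p <= pt n)%N /\ (pt n + mu p <= N)%N) ->
  (forall k N n, 0 < k -> adm N n ->
    0 <= node k (pt n) + e * k /\ node k (pt n) + (e + 1) * k <= node k N) ->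
  ncoef e p.+1 = - ((-1) ^+ s * C) ->
  approx_order formula adm pt p /\ error_constant formula adm pt p C.
Proof.
move=> p0 e01 formulaE admP admE cE.
pose K := remainder_const e p; have K0 : 0 <= K := remainder_const_ge0 e p.
(* Admissibility then forces [N >= 1], whence [k <= T]. *)
have mup : (0 < mu p + tau p)%N by rewrite /mu /tau; lia.
have geom T k N n : 0 < k -> node k N = T -> adm N n ->
    [/\ k <= T, 0 <= node k (pt n) - (mu p + tau p)%:R * k &
        node k (pt n) + (mu p)%:R * k <= T].
  move=> k0 <- /admP[lo hi]; rewrite /node -mulrBl -mulrDl -natrD.
  have N1 : (0 < N)%N.
    exact: leq_trans (leq_trans lo (leq_trans (leq_addr _ _) hi)).
  split; first by rewrite ler_peMl ?ler1n // ltW.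
    by rewrite mulr_ge0 ?subr_ge0 ?ler_nat // ltW.
  by rewrite ler_wpM2r ?ler_nat // ltW.
have est T u d E : class_C p.+1 `[0, T] u -> 0 <= E ->
    (forall x y, 0 <= x <= T -> 0 <= y <= T -> `|y - x| < d ->
      `|derive_within_n `[0, T] p.+1 u y - derive_within_n `[0, T] p.+1 u x|
        <= E) ->
    forall k N n, 0 < k -> node k N = T -> adm N n -> p%:R * k < d ->
    `|remainder formula pt T k u n - ((-1) ^+ s * C * k ^+ p)
       *: derive_within_n `[0, T] p.+1 u (node k (pt n))| <= K * E * k ^+ p.
  move=> [du _] E0 unif k N n k0 NT admn kd.
  have [kT lo hi] := geom T k N n k0 NT admn.
  have [elo ehi] := admE k N n k0 admn; rewrite NT in ehi.
  have m0 : 0 <= (mu p)%:R * k by rewrite mulr_ge0 // ltW.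
  have t0 : 0 <= (mu p + tau p)%:R * k by rewrite mulr_ge0 // ltW.
  rewrite /remainder formulaE // -[- (((-1) ^+ s * C * _) *: _)]scaleNr -mulNr -cE.
  apply: (@remainder_estimate R X e p k _ d E
    (fun j => derive_within_n `[0, T] j u (node k (pt n)))) => // y yt yd.
  apply: taylor_within (unif) _ _ _ _ yd => [j x jp xT||].
  - by apply: du; rewrite //= in_itv.
  - by lra.
  - have e0k : e * k <= 0 by apply: mulr_le0_ge0; lra.
    have e1k : 0 <= (e + 1) * k by apply: mulr_ge0; lra.
    by case: yt => [|[->|->]]; lra.
split.
  move=> T u T0 uC.
  have [M M0 uM] := segment_bounded uC.2.
  (* The oscillation is at most [2 * M]; the second summand bounds the leading error term. *)
  exists (K * (2 * M) + `|C| * M) => k N n k0 NT admn.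
  have [kT lo hi] := geom T k N n k0 NT admn.
  set t := node k (pt n) in lo hi *.
  pose z := ((-1) ^+ s * C * k ^+ p) *: derive_within_n `[0, T] p.+1 u t.
  have tT : 0 <= t <= T.
    have m0 : 0 <= (mu p)%:R * k by rewrite mulr_ge0 // ltW.
    have t0 : 0 <= (mu p + tau p)%:R * k by rewrite mulr_ge0 // ltW.
    by lra.
  rewrite -(subrK z (remainder _ _ _ _ _ _)) (le_trans (ler_normD _ _)) //.
  rewrite mulrDl lerD //.
    (* With this radius [p * k < d] holds for every admissible [k], as [k <= T]. *)
    apply: (est _ _ (p%:R * T + 1)) NT admn _ => //.
      by rewrite mulr_ge0 // ltW.
      move=> x y xT yT _; rewrite (le_trans (ler_normB _ _)) //.
      by have := uM x xT; have := uM y yT; lra.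
    by rewrite (le_lt_trans (_ : _ <= p%:R * T)) ?ltrDl // ler_wpM2l.
  rewrite /z normrZ !normrM normrX normrN1 expr1n mul1r.
  rewrite (gtr0_norm (exprn_gt0 _ k0)).
  by rewrite mulrAC ler_wpM2r ?exprn_ge0 ?(ltW k0) // ler_wpM2l // uM.
exists s => T u T0 uC eps eps0.
(* Dividing by [K + 1] gives [K * E <= eps] and stays legitimate if [K = 0]. *)
have E0 : 0 < eps / (K + 1) by rewrite divr_gt0 // ltr_wpDl.
have [d d0 unif] := segment_unif_continuous uC.2 E0.
have pR0 : 0 < p%:R :> R by rewrite ltr0n.
exists (d / p%:R) => [|k N n /andP[k0 kd] NT admn]; first by rewrite divr_gt0.
have pkd : p%:R * k < d by rewrite mulrC -ltr_pdivlMr.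
apply: le_trans (est T u d _ uC (ltW E0) unif k N n k0 NT admn pkd) _.
rewrite ler_wpM2r ?exprn_ge0 ?(ltW k0) // mulrCA ler_piMr ?(ltW eps0) //.
by rewrite ler_pdivrMr ?ltr_wpDl // mul1r lerDl.
Qed.

Lemma formula1E p k u n : 0 < k ->
  formula1 acoef p k u n = k^-1 *: scaled_approx 0 p k (node k n) u.
Proof.
move=> k0; rewrite /formula1 /scaled_approx [RHS]scalerBr mul0r addr0 add0r mul1r.
have -> : node k n.+1 = node k n + k by rewrite /node -natr1; ring.
congr (_ - _); rewrite scaler_sumr !big_nat; apply: eq_bigr => i /andP[i2 _].
rewrite scalerA ncoef0 //; congr (_ *: _).
by case: i i2 => // i _; rewrite exprS /=; field; rewrite gt_eqF.
Qed.

Lemma formula2E p k u n : 0 < k ->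
  formula2 bcoef p k u n = k^-1 *: scaled_approx (-1) p k (node k n.+1) u.
Proof.
move=> k0; rewrite /formula2 /scaled_approx [RHS]scalerBr addNr mul0r addr0.
have -> : node k n.+1 + -1 * k = node k n by rewrite /node -natr1; ring.
congr (_ + _); rewrite -scalerN -sumrN scaler_sumr !big_nat.
apply: eq_bigr => i /andP[i2 _].
rewrite -scaleNr scalerA ncoefN1 //; congr (_ *: _).
by case: i i2 => // i _; rewrite exprS /=; field; rewrite gt_eqF.
Qed.

End Approximations.

Theorem theorem7 (R : realType) (X : completeNormedModType R) :
  exists a b : nat -> R,
    (forall p : nat, (0 < p)%N ->
      approx_order (X := X) (formula1 a p) (admissible1 p) id p /\
      approx_order (X := X) (formula2 b p) (admissible2 p) S p /\
      error_constant (X := X) (formula1 a p) (admissible1 p) id p (a p.+1) /\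
      error_constant (X := X) (formula2 b p) (admissible2 p) S p (b p.+1)) /\
    a 2%N = b 2%N /\
    (forall i : nat, (3 <= i)%N -> a i = - b i) /\
    a 2%N = 1 / 2 /\
    a 3%N = 1 / (3`!)%:R /\
    a 4%N = 2 / (4`!)%:R /\
    a 5%N = - (4 / (5`!)%:R) /\
    a 6%N = - (12 / (6`!)%:R) /\
    a 7%N = 36 / (7`!)%:R /\
    a 8%N = 144 / (8`!)%:R /\
    a 9%N = - (576 / (9`!)%:R) /\
    a 10%N = - (2880 / (10`!)%:R) /\
    a 11%N = 14400 / (11`!)%:R.
Proof.
exists acoef, bcoef; split.
  move=> p p0.
  (* The leading error is [- c_(p+1) k^p u^(p+1)] with [c_(p+1) = a_(p+1)]: the sign is negative,
     hence [true]. *)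
  have [] := @approx_order_error_constant R X 0 p (formula1 acoef p)
    (admissible1 p) id (acoef p.+1) true.
  - exact: p0.
  - by rewrite lexx lerN10.
  - exact: formula1E.
  - by move=> N n /and3P[].
  - move=> k N n k0 /and3P[_ _ nN]; rewrite mul0r addr0 add0r mul1r /node; split.
      by rewrite mulr_ge0 // ltW.
    by rewrite -{2}[k]mul1r -mulrDl natr1 ler_wpM2r ?ler_nat // ltW.
  - by rewrite ncoef0 // expr1 mulN1r opprK.
  (* Here [c_(p+1) = - b_(p+1)], so the sign is positive, hence [false]. *)
  have [] := @approx_order_error_constant R X (-1) p (formula2 bcoef p)
    (admissible2 p) S (bcoef p.+1) false.
  - exact: p0.
  - by rewrite lexx lerN10.
  - exact: formula2E.
  - by move=> N n /and3P[lo _ hi]; split=> //; exact: leqW.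
  - move=> k N n k0 /and3P[_ _ nN]; rewrite addNr mul0r addr0 mulN1r /node; split.
      by rewrite -natr1 mulrDl mul1r addrK mulr_ge0 // ltW.
    by rewrite ler_wpM2r ?ler_nat ?(leq_trans (leq_addr _ _) nN) // ltW.
  - by rewrite ncoefN1 // expr0 mul1r.
  by [].
split; first by rewrite acoef2 bcoef2.
split; first exact: acoef_ge3.
split; first exact: acoef2.
exact: acoef_values.
Qed.
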